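(* If $\mu$ is a (non-zero) finite Borel measure on $\mathbb{R}^d$ with \[ \int_{\mathbb{R}^d}|\widehat\mu(z)|^4\,dz<\infty, \] then $\mathcal{L}^1(D(\operatorname{spt}(\mu)))>0$.
   Context: $\widehat\mu(z)=\int e^{-2\pi i z\cdot x}\,d\mu(x)$ is the Fourier transform of $\mu$, $\operatorname{spt}(\mu)$ is its (closed) support, $D(X)=\{|x-y|:x,y\in X\}$ is the distance set of $X\subseteq\mathbb{R}^d$, and $\mathcal{L}^1$ is 1-dimensional Lebesgue measure on $\mathbb{R}$. *)

(* Defs.v *)
From HB Require Import structures.
From mathcomp Require Import all_boot all_order all_algebra.
From mathcomp Require Import all_classical all_reals all_analysis.
From mathcomp Require Import measurable_realfun complex.
Import Order.TTheory GRing.Theory Num.Theory.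
Import numFieldNormedType.Exports.

Set Implicit Arguments.
Unset Strict Implicit.
Unset Printing Implicit Defensive.

Local Open Scope classical_set_scope.
Local Open Scope ring_scope.

(* R^d is the type 'rV[R]_d of row vectors with its entrywise topology, which is
   the Euclidean one; borelRn is the same type with its Borel sigma-algebra. *)
Definition borelRn (R : realType) (d : nat) :=
  g_sigma_algebraType (@open 'rV[R]_d).

Section euclidean.
Context {R : realType} {d : nat}.
Implicit Types x y : 'rV[R]_d.

Definition dotmul x y : R := \sum_(i < d) x 0 i * y 0 i.

(* The library norm `|x| on 'rV[R]_d is the sup norm, hence this definition. *)
Definition enorm x : R := Num.sqrt (dotmul x x).

Definition distance_set (X : set 'rV[R]_d) : set R :=
  [set enorm (x - y) | x in X & y in X].

End euclidean.

Section borelRn_theory.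
Context {R : realType}.

Definition coordRn n (i : 'I_n) : borelRn R n -> measurableTypeR R :=
  fun x => (x : 'rV[R]_n) 0 i.

Lemma measurable_coordRn n (i : 'I_n) : measurable_fun setT (coordRn i).
Proof.
apply: (measurability _ (RGenOpens.measurableE R)) => _ [_ [a [b ->] <-]].
rewrite setTI; apply: sub_sigma_algebra.
have /continuousP := @coord_continuous R 1 n 0 i.
by apply; exact: interval_open.
Qed.

Definition rat_ball n (p : 'rV[rat]_n * nat) : set 'rV[R]_n :=
  ball (map_mx (@ratr R) p.1) (p.2.+1%:R^-1).

Lemma open_bigcup_rat_ball n (U : set 'rV[R]_n) : open U ->
  U = \bigcup_(p in [set p | rat_ball p `<=` U]) rat_ball p.
Proof.
move=> oU; apply/seteqP; split; last by move=> x [p /= pU /pU].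
move=> x Ux.
have /nbhs_ballP[e /= e0 eU] : nbhs x U by apply: open_nbhs_nbhs; split.
have e20 : 0 < e / 2 by rewrite divr_gt0.
have [k] := ltr_add_invr e20; rewrite add0r => ke.
have k0 : 0 < k.+1%:R^-1 :> R by rewrite invr_gt0.
have Q i : {q : rat | `|x 0 i - ratr q| < k.+1%:R^-1}.
  apply: cid.
  have /rat_in_itvoo[q] : x 0 i - k.+1%:R^-1 < x 0 i + k.+1%:R^-1.
    by rewrite ltrD2l (lt_trans _ k0)// oppr_lt0.
  by rewrite in_itv/= -ltr_distlC distrC => qx; exists q; rewrite distrC.
pose q : 'rV[rat]_n := \row_i sval (Q i).
have xq : rat_ball (q, k) x.
  split=> // i j; rewrite !mxE ord1 -ball_normE/= distrC.
  exact: (svalP (Q j)).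
exists (q, k) => // y qy; apply: eU; rewrite (splitr e).
apply: (@ball_triangle _ _ (map_mx (@ratr R) q)).
  by apply: ball_sym; apply: le_ball xq; exact: ltW.
by apply: le_ball qy; exact: ltW.
Qed.

Lemma measurable_to_borelRn d0 (T : measurableType d0) n (f : T -> borelRn R n) :
  (forall i, measurable_fun setT (coordRn i \o f)) -> measurable_fun setT f.
Proof.
move=> mf; apply: (@measurability _ _ _ _ _ f (@open 'rV[R]_n)) => // _ [U oU <-].
rewrite setTI (open_bigcup_rat_ball oU) preimage_bigcup bigcup_mkcond.
apply: countable_bigcupT_measurable => [|p]; first exact: countableP.
case: ifPn => // _.
rewrite [X in measurable X](_ : _ = \bigcap_(i in [set: 'I_n])
    ((coordRn i \o f) @^-1` ball (ratr (p.1 0 i) : R) p.2.+1%:R^-1)); last first.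
  apply/seteqP; split => x /=.
    by move=> [_ fx] i _ /=; have := fx 0 i; rewrite mxE.
  move=> fx; split; first by rewrite invr_gt0.
  by move=> i j; rewrite !mxE ord1; exact: (fx j).
apply: fin_bigcap_measurable; first exact: finite_finset.
move=> i _; rewrite -[X in measurable X]setTI.
by apply: mf => //; exact: measurable_ball.
Qed.

Definition consRn n (p : measurableTypeR R * borelRn R n) : borelRn R n.+1 :=
  \row_(i < n.+1) if unlift ord0 i is Some j then coordRn j p.2 else p.1.

Definition unconsRn n (x : borelRn R n.+1) : measurableTypeR R * borelRn R n :=
  (coordRn ord0 x, \row_(j < n) coordRn (lift ord0 j) x).

Lemma consRnK n : cancel (@consRn n) (@unconsRn n).
Proof.
move=> [a x]; rewrite /unconsRn /consRn /coordRn/= mxE unlift_none.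
by congr (_, _); apply/rowP => j; rewrite !mxE liftK.
Qed.

Lemma unconsRnK n : cancel (@unconsRn n) (@consRn n).
Proof.
move=> x; apply/rowP => i; rewrite mxE.
by case: unliftP => [j|] ->; rewrite /coordRn//= mxE.
Qed.

Lemma measurable_consRn n : measurable_fun setT (@consRn n).
Proof.
apply: measurable_to_borelRn => i; case: (unliftP ord0 i) => [j|] ->.
  rewrite (_ : _ \o _ = @coordRn n j \o snd).
    by apply: measurableT_comp; [exact: measurable_coordRn|exact: measurable_snd].
  by apply/funext => p /=; rewrite /coordRn mxE liftK.
rewrite (_ : _ \o _ = fst); first exact: measurable_fst.
by apply/funext => p /=; rewrite /coordRn mxE unlift_none.
Qed.

Lemma measurable_unconsRn n : measurable_fun setT (@unconsRn n).
Proof.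
apply: measurable_fun_pair; first exact: measurable_coordRn.
apply: measurable_to_borelRn => i.
rewrite (_ : _ \o _ = coordRn (lift ord0 i)); first exact: measurable_coordRn.
by apply/funext => x; rewrite /coordRn/= mxE.
Qed.

HB.instance Definition _ n :=
  isMeasurableFun.Build _ _ _ _ (@consRn n) (@measurable_consRn n).

End borelRn_theory.

Section consRn_measure.
Local Open Scope ereal_scope.
Context {R : realType} {n : nat}.
Variable m : {sigma_finite_measure set (borelRn R n) -> \bar R}.

Definition cons_measure : set (borelRn R n.+1) -> \bar R :=
  pushforward (lebesgue_measure \x m) (@consRn R n).

Let cons_measure0 : cons_measure set0 = 0.
Proof. by rewrite /cons_measure /pushforward preimage_set0 measure0. Qed.

Let cons_measure_ge0 A : 0 <= cons_measure A.
Proof. exact: measure_ge0. Qed.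

Let cons_measure_sigma_additive : semi_sigma_additive cons_measure.
Proof. exact: measure_semi_sigma_additive. Qed.

HB.instance Definition _ := isMeasure.Build _ _ _ cons_measure
  cons_measure0 cons_measure_ge0 cons_measure_sigma_additive.

Let cons_measure_sigma_finite : sigma_finite setT cons_measure.
Proof.
have /sigma_finiteP[F [FT ndF mF]] := sigma_finiteT (@lebesgue_measure R).
have /sigma_finiteP[G [GT ndG mG]] := sigma_finiteT m.
exists (fun k => @unconsRn R n @^-1` (F k `*` G k)).
  apply/esym; rewrite -subTset => x _.
  have : (\bigcup_i F i) (unconsRn x).1 by rewrite -FT.
  have : (\bigcup_i G i) (unconsRn x).2 by rewrite -GT.
  move=> [j _ Gj] [i _ Fi]; exists (maxn i j) => //; split.
    by have /subsetPset := ndF _ _ (leq_maxl i j); apply.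
  by have /subsetPset := ndG _ _ (leq_maxr i j); apply.
move=> k; have [mFk Fkoo] := mF k; have [mGk Gkoo] := mG k; split.
  rewrite -[X in measurable X]setTI; apply: measurable_unconsRn => //.
  exact: measurableX.
rewrite /cons_measure /pushforward -comp_preimage.
rewrite (_ : _ \o _ = id) ?preimage_id; last first.
  by apply/funext => p /=; rewrite consRnK.
by rewrite product_measure1E// lte_mul_pinfty// ge0_fin_numE.
Qed.

HB.instance Definition _ := Measure_isSigmaFinite.Build _ _ _ cons_measure
  cons_measure_sigma_finite.

End consRn_measure.

(* Lebesgue measure on R^d, as the d-fold product of lebesgue_measure. *)
Fixpoint lebesgue_Rn (R : realType) (d : nat) :
    {sigma_finite_measure set (borelRn R d) -> \bar R} :=
  match d with
  | 0 => \d_((0 : 'rV[R]_0) : borelRn R 0)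
  | d'.+1 => cons_measure (lebesgue_Rn R d')
  end.

Section fourier.
Local Open Scope complex_scope.
Context {R : realType} {d : nat}.
Variable mu : {measure set (borelRn R d) -> \bar R}.

(* e^(it) *)
Definition expi (t : R) : R[i] := cos t +i* sin t.

(* The library integral is real-valued: integrate real and imaginary parts. *)
Definition Cintegral (f : borelRn R d -> R[i]) : R[i] :=
  (\int[mu]_x complex.Re (f x))%R +i* (\int[mu]_x complex.Im (f x))%R.

Definition fourier (z : 'rV[R]_d) : R[i] :=
  Cintegral (fun x => expi (- (2 * pi * dotmul z x))).

Definition msupport : set 'rV[R]_d :=
  \bigcap_(F in [set F | closed F /\ mu (~` F) = 0%E]) F.

End fourier.

(* Main.v *)
Require Import Defs.
From HB Require Import structures.
From mathcomp Require Import all_boot all_order all_algebra.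
From mathcomp Require Import all_classical all_reals all_analysis.
From mathcomp Require Import measurable_realfun complex.
From mathcomp Require Import ring lra.
Import Order.TTheory GRing.Theory Num.Theory.
Import numFieldNormedType.Exports.

(* Let nu be the law of x - y under mu x mu.  Its Fourier transform is |mu^|^2,
   so the hypothesis says that nu^ is in L^2, and nu is absolutely continuous.
   If the distance set were null, Fubini would make the set of vectors whose
   length lies in it null in R^d, although nu gives positive mass to S - S for
   a compact S in the support with mu(S) > 0.
   Absolute continuity needs no Plancherel theorem: integrating |nu^|^2 against
   a product of tent functions, whose Fourier transforms (Fejer kernels) are
   nonnegative and bounded below near 0, gives
   (nu x nu){|w - w'| < 2e} <= C (2e)^d, i.e. the averages
   (2e)^-d nu(B(x, e)) are bounded in L^2(dx) uniformly in e.  Hence nu(A) is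
   controlled by the volume of the e-neighbourhood of A, which tends to 0 when
   A is compact and Lebesgue null. *)

Set Implicit Arguments.
Unset Strict Implicit.
Unset Printing Implicit Defensive.

Local Open Scope classical_set_scope.
Local Open Scope ring_scope.

(** * Borel structure of R^n *)

Section borelRn_measurability.
Context {R : realType} {n : nat}.

Lemma open_measurable_borelRn (U : set 'rV[R]_n) :
  open U -> measurable (U : set (borelRn R n)).
Proof. by move=> oU; exact: sub_sigma_algebra. Qed.

Lemma closed_measurable_borelRn (F : set 'rV[R]_n) :
  closed F -> measurable (F : set (borelRn R n)).
Proof.
move=> cF; rewrite -[X in measurable X]setCK; apply: measurableC.
by apply: open_measurable_borelRn; exact: closed_openC.
Qed.

Lemma continuous_measurable_borelRn (f : 'rV[R]_n -> R) :
  continuous f -> measurable_fun setT (f : borelRn R n -> measurableTypeR R).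
Proof.
move=> cf; apply: (measurability _ (RGenOpens.measurableE R)) => _ [_ [a [b ->] <-]].
rewrite setTI; apply: open_measurable_borelRn.
by move/continuousP : cf; apply; exact: interval_open.
Qed.

Context {d : measure_display} {T : measurableType d}.
Implicit Types f g : T -> borelRn R n.

Lemma measurable_coord f i : measurable_fun setT f ->
  measurable_fun setT (fun t => (f t : 'rV[R]_n) 0 i).
Proof. by move=> mf; apply: (measurableT_comp (measurable_coordRn i) mf). Qed.

Lemma measurable_dotmul f g : measurable_fun setT f -> measurable_fun setT g ->
  measurable_fun setT (fun t => dotmul (f t : 'rV[R]_n) (g t : 'rV[R]_n)).
Proof.
move=> mf mg; apply: measurable_sum => i.
by apply: measurable_funM; exact: measurable_coord.
Qed.

Lemma measurable_borelRnB f g : measurable_fun setT f -> measurable_fun setT g ->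
  measurable_fun setT
    (fun t => ((f t : 'rV[R]_n) - (g t : 'rV[R]_n)) : borelRn R n).
Proof.
move=> mf mg; apply: measurable_to_borelRn => i.
rewrite (_ : _ \o _ = (fun t => (f t : 'rV[R]_n) 0 i - (g t : 'rV[R]_n) 0 i)).
  by apply: measurable_funB; exact: measurable_coord.
by apply/funext => t; rewrite /coordRn /= !mxE.
Qed.

End borelRn_measurability.

Section norms.
Context {R : realType} {n : nat}.
Implicit Types x y z : 'rV[R]_n.

Lemma dotmul_ge0 x : 0 <= dotmul x x.
Proof. by apply: sumr_ge0 => i _; rewrite -expr2 sqr_ge0. Qed.

Lemma dotmulDr x y z : dotmul x (y + z) = dotmul x y + dotmul x z.
Proof.
by rewrite -big_split; apply: eq_bigr => i _; rewrite mxE mulrDr.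
Qed.

Lemma dotmulBr x y z : dotmul x (y - z) = dotmul x y - dotmul x z.
Proof.
by rewrite -sumrB; apply: eq_bigr => i _; rewrite !mxE mulrBr.
Qed.

Lemma continuous_enorm : continuous (@enorm R n).
Proof.
have cd : continuous (fun x : 'rV[R]_n => dotmul x x).
  apply: continuous_big => [|i _]; first exact: add_continuous.
  by move=> x; apply: (@cvgM _ _ (nbhs x)); exact: (@coord_continuous R 1 n 0 i x).
move=> x; apply: (continuous_comp (cd x)); exact: sqrt_continuous.
Qed.

Lemma ball_rVP x (r : R) y : 0 < r ->
  ball x r y <-> forall i, `|x 0 i - y 0 i| < r.
Proof.
move=> r0; split=> [[_ xy] i|xy]; first exact: xy.
by split=> // i j; rewrite ord1; exact: xy.
Qed.

(** [T] will be a product with its product sigma-algebra, where openness of the relation does not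
    directly give measurability. Sup-norm balls are cubes, so the relation splits into finitely many
    scalar inequalities. *)
Lemma measurable_ball_rV (r : R) d (T : measurableType d) (f g : T -> borelRn R n) :
  measurable_fun setT f -> measurable_fun setT g ->
  measurable [set t | ball (f t : 'rV[R]_n) r (g t : 'rV[R]_n)].
Proof.
move=> mf mg; have [r0|r0] := ltP 0 r; last first.
  rewrite (_ : [set t | _] = set0)//; apply/seteqP; split=> // t [/=].
  by rewrite ltNge r0.
rewrite (_ : [set t | _] = \bigcap_(i in [set: 'I_n])
    [set t | `|(f t : 'rV[R]_n) 0 i - (g t : 'rV[R]_n) 0 i| < r]); last first.
  apply/seteqP; split=> t /=.
    by move=> /(ball_rVP _ _ r0) ftg i _ /=.
  by move=> ftg; apply/ball_rVP => // i; exact: ftg.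
apply: fin_bigcap_measurable; first exact: finite_finset.
move=> i _; have mh : measurable_fun setT
    (fun t => `|(f t : 'rV[R]_n) 0 i - (g t : 'rV[R]_n) 0 i|).
  by apply: measurableT_comp => //; apply: measurable_funB; exact: measurable_coord.
have := mh measurableT _ (measurable_itv `]-oo, r[); rewrite setTI.
by congr measurable; apply/seteqP; split=> t /=; rewrite in_itv.
Qed.

End norms.

(** * Lebesgue measure on R^n *)

Section lebesgue_Rn_theory.
Context {R : realType}.
Local Notation leb := (@lebesgue_measure R).

Lemma consRn0 n (p : measurableTypeR R * borelRn R n) :
  (consRn p : 'rV[R]_n.+1) 0 ord0 = p.1.
Proof. by rewrite mxE unlift_none. Qed.

Lemma consRn_lift n (p : measurableTypeR R * borelRn R n) (i : 'I_n) :
  (consRn p : 'rV[R]_n.+1) 0 (lift ord0 i) = (p.2 : 'rV[R]_n) 0 i.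
Proof. by rewrite mxE liftK. Qed.

(** Sup-norm balls are cubes of side [r *+ 2], and a cube in one more dimension is an interval times
    a cube. *)
Lemma lebesgue_Rn_ball n (x : 'rV[R]_n) (r : R) : 0 < r ->
  lebesgue_Rn R n (ball x r) = ((r *+ 2) ^+ n)%:E.
Proof.
move=> r0; elim: n x => [|n IH] x.
  rewrite expr0 /= diracE mem_set//; split=> // i; by case.
change (pushforward (leb \x lebesgue_Rn R n)%E (@consRn R n) (ball x r) =
  ((r *+ 2) ^+ n.+1)%:E).
have -> : pushforward (leb \x lebesgue_Rn R n)%E (@consRn R n) (ball x r) =
    (leb \x lebesgue_Rn R n)%E (ball (x 0 ord0) r `*`
      (ball (\row_i x 0 (lift ord0 i)) r : set (borelRn R n))).
  rewrite /pushforward; congr ((leb \x lebesgue_Rn R n)%E _);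
    apply/seteqP; split=> [[t y]|[t y] []] /=.
    move/(ball_rVP _ _ r0) => xy; split.
      by have := xy ord0; rewrite consRn0.
    apply/ball_rVP => // i.
    by have := xy (lift ord0 i); rewrite consRn_lift mxE.
  move=> xt /(ball_rVP _ _ r0) xy; apply/ball_rVP => // i.
  case: (unliftP ord0 i) => [j|] ->.
    by have := xy j; rewrite consRn_lift mxE.
  by rewrite consRn0.
rewrite product_measure1E//; last first.
- by apply: open_measurable_borelRn; exact: ball_open.
- exact: measurable_ball.
rewrite IH exprS EFinM; congr (_ * _)%E.
by apply: lebesgue_measure_ball; exact: ltW.
Qed.

Local Open Scope ereal_scope.

Lemma integral_lebesgue_RnS n (f : borelRn R n.+1 -> \bar R) :
  (lebesgue_Rn R n.+1).-integrable setT f ->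
  \int[lebesgue_Rn R n.+1]_x f x =
  \int[leb]_t \int[lebesgue_Rn R n]_y f (consRn (t, y)).
Proof.
move=> intf; have mf := measurable_int _ intf.
have mfc : measurable_fun setT (f \o @consRn R n).
  by apply: measurableT_comp => //; exact: measurable_consRn.
have intfc : (leb \x lebesgue_Rn R n).-integrable setT (f \o @consRn R n).
  apply/integrableP; split => //.
  case/integrableP : intf => _.
  change (\int[pushforward (leb \x lebesgue_Rn R n) (@consRn R n)]_x `|f x|
    < +oo -> \int[leb \x lebesgue_Rn R n]_x `|(f \o @consRn R n) x| < +oo).
  by rewrite ge0_integral_pushforward//=; exact: measurableT_comp.
change (\int[pushforward (leb \x lebesgue_Rn R n) (@consRn R n)]_x f x = 
  \int[leb]_t \int[lebesgue_Rn R n]_y f (consRn (t, y))).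
by rewrite integral_pushforward// preimage_setT -integral12_prod_meas1.
Qed.

(** Tonelli with the first coordinate integrated innermost: only lines parallel to the first axis
    have to be inspected. *)
Lemma lebesgue_RnS_null n (A : set (borelRn R n.+1)) : measurable A ->
  (forall y, leb [set t | A (consRn (t, y))] = 0) -> lebesgue_Rn R n.+1 A = 0.
Proof.
move=> mA A0.
have mcA : measurable (@consRn R n @^-1` A).
  by rewrite -[X in measurable X]setTI; exact: measurable_consRn.
transitivity ((leb \x lebesgue_Rn R n) (@consRn R n @^-1` A)); first by [].
rewrite -[X in (leb \x _) X]setIT -integral_indic// (fubini_tonelli2 (EFin \o \1__)).
- rewrite integral0_eq// => y _; rewrite /fubini_G /= -[RHS](A0 y).
  rewrite -[in RHS](setIT [set t | _]) -integral_indic//.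
  rewrite (_ : [set t | _] = ysection (@consRn R n @^-1` A) y).
    exact: measurable_ysection.
  by apply/seteqP; split=> t /=; rewrite /ysection/= inE.
- by apply/measurable_EFinP; exact: measurable_indic.
- by move=> p; rewrite lee_fin.
Qed.

End lebesgue_Rn_theory.

(** * The Fejer kernel *)

Section fejer.
Context {R : realType}.
Local Notation leb := (@lebesgue_measure R).
Implicit Types a b c t u v theta T : R.

Lemma integral_is_derive (f F : R -> R) a b : a < b -> continuous f ->
  (forall t, is_derive t 1 F (f t)) ->
  (\int[leb]_(t in `[a, b]) (f t)%:E = (F b - F a)%:E)%E.
Proof.
move=> ab cf dF; rewrite (@continuous_FTC2 _ f F a b)//.
- exact: continuous_subspaceT.
- have cF : continuous F.
    by move=> x; apply: differentiable_continuous; apply/derivable1_diffP.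
  split=> [x _||]; first by [].
    by apply: cvg_at_right_filter; exact: cF.
  by apply: cvg_at_left_filter; exact: cF.
- by move=> x _; rewrite derive1E; apply: derive_val.
Qed.

Lemma continuous_cos_affine a theta :
  continuous (fun t : R => cos (a * t + theta)).
Proof.
move=> t; apply: continuous_comp; last exact: continuous_cos.
apply: cvgD; last exact: cvg_cst.
by apply: cvgM; [exact: cvg_cst|exact: cvg_id].
Qed.

Lemma continuous_affine_cos a theta k :
  continuous (fun t : R => (1 - k * t) * cos (a * t + theta)).
Proof.
move=> t; apply: cvgM; last exact: continuous_cos_affine.
by apply: cvgB; [exact: cvg_cst|apply: cvgM; [exact: cvg_cst|exact: cvg_id]].
Qed.

(** [F] is the antiderivative found by integration by parts; the affine factor stands for one side
    of a tent. *)
Lemma integral_affine_cos a theta k b c : a != 0 -> b < c ->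
  let F t := (1 - k * t) * sin (a * t + theta) / a -
             k * cos (a * t + theta) / a ^+ 2 in
  (\int[leb]_(t in `[b, c]) ((1 - k * t) * cos (a * t + theta))%:E =
    (F c - F b)%:E)%E.
Proof.
move=> a0 bc F; apply: integral_is_derive => //.
  exact: continuous_affine_cos.
move=> t.
have dl : is_derive t 1 (fun t : R => a * t + theta) a.
  by apply: is_derive_eq; rewrite addr0 -[RHS]mulr1.
have ds : is_derive t 1 (fun t => sin (a * t + theta)) (cos (a * t + theta) * a).
  exact: (@is_derive1_comp _ sin (fun t => a * t + theta)).
have dc : is_derive t 1 (fun t => cos (a * t + theta)) (- sin (a * t + theta) * a).
  exact: (@is_derive1_comp _ cos (fun t => a * t + theta)).
apply: is_derive_eq.
by rewrite /GRing.scale /=; field.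
Qed.

(** Frequency 0 is treated apart because the antiderivative above divides by [a]. The term [0 * t]
    is kept so that the integrand matches the general one. *)
Lemma integral_affine_cst theta k b c : b < c ->
  (\int[leb]_(t in `[b, c]) ((1 - k * t) * cos (0 * t + theta))%:E =
    ((c - b - k * (c ^+ 2 - b ^+ 2) / 2) * cos theta)%:E)%E.
Proof.
move=> bc; pose F t := (t - k * t ^+ 2 / 2) * cos theta.
have dF t : is_derive t 1 F ((1 - k * t) * cos (0 * t + theta)).
  rewrite mul0r add0r; apply: is_derive_eq.
  by rewrite /GRing.scale /=; field.
rewrite (integral_is_derive bc _ dF); last exact: continuous_affine_cos.
by congr EFin; rewrite /F; field.
Qed.

Definition tent T t : R := Num.max 0 (1 - `|t| / T).

(* [\int tent T t * cos (a * t) dt]; the formula for [a != 0] would give the junk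
   value 0 at [a = 0]. *)
Definition fejer T a : R :=
  if a == 0 then T else 2 * (1 - cos (a * T)) / (a ^+ 2 * T).

Lemma tent_ge0 T t : 0 <= tent T t.
Proof. by rewrite le_max lexx. Qed.

Lemma tent_le1 T t : 0 < T -> tent T t <= 1.
Proof.
move=> T0; rewrite ge_max ler01 /= gerBl.
by rewrite divr_ge0// ltW.
Qed.

Lemma tent_eq0 T t : 0 < T -> T <= `|t| -> tent T t = 0.
Proof.
move=> T0 Tt; apply/max_idPl.
by rewrite subr_le0 ler_pdivlMr// mul1r.
Qed.

Lemma continuous_tent T : continuous (tent T).
Proof.
move=> t; apply: (@continuous_max _ _ (cst 0) (fun t => 1 - `|t| / T)).
  exact: cst_continuous.
apply: cvgB; first exact: cvg_cst.
apply: cvgM; last exact: cvg_cst.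
exact: norm_continuous.
Qed.

(** The tent is even, so the sine part of [cos (a * t + theta)] integrates to 0 and the phase
    factors out. The phase serves the induction on the dimension, where one coordinate acts as a
    phase for the others. *)
Lemma integral_tent_cos T a theta : 0 < T ->
  (\int[leb]_t (tent T t * cos (a * t + theta))%:E =
    (fejer T a * cos theta)%:E)%E.
Proof.
move=> T0; pose g t := tent T t * cos (a * t + theta).
have mg (D : set R) : measurable_fun D g.
  apply: measurable_funTS; apply: continuous_measurable_fun => t.
  apply: cvgM; first exact: continuous_tent.
  exact: continuous_cos_affine.
have NT0 : - T < 0 by rewrite oppr_lt0.
have TT : [set` `[- T, T]%R] = `[(- T), 0[ `|` `[0, T] :> set R.
  by rewrite -itv_bndbnd_setU// bnd_simp ltW.
transitivity (\int[leb]_(t in `[(- T)%R, T]) (g t)%:E)%E.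
  rewrite [RHS]integral_mkcond; apply: eq_integral => t _.
  rewrite patchE; case: ifPn => // /negP tT; rewrite /g tent_eq0 ?mul0r//.
  rewrite leNgt; apply/negP => tT'; apply: tT; rewrite inE/= in_itv/=.
  by rewrite -ler_norml ltW.
rewrite TT integral_setU//; last 2 first.
- by apply/measurable_EFinP; exact: mg.
- by apply/disj_setPS => t [] /=; rewrite !in_itv/=; lra.
rewrite integral_itv_bndo_bndc; last exact/measurable_EFinP.
(* On each half the tent is affine, [1 - k * t] with [k] equal to [- T^-1] on the left and to [T^-1]
   on the right. *)
have -> : (\int[leb]_(t in `[(- T)%R, 0%R]) (g t)%:E =
    \int[leb]_(t in `[(- T)%R, 0%R]) ((1 - (- T^-1) * t) * cos (a * t + theta))%:E)%E.
  apply: eq_integral => t; rewrite inE/= in_itv/= => /andP[t1 t2]; congr EFin.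
  rewrite /g /tent ler0_norm// (max_idPr _)//.
    by field; exact: lt0r_neq0.
  by rewrite subr_ge0 ler_pdivrMr// mul1r; lra.
have -> : (\int[leb]_(t in `[0%R, T]) (g t)%:E =
    \int[leb]_(t in `[0%R, T]) ((1 - T^-1 * t) * cos (a * t + theta))%:E)%E.
  apply: eq_integral => t; rewrite inE/= in_itv/= => /andP[t1 t2]; congr EFin.
  rewrite /g /tent ger0_norm// (max_idPr _)//.
    by field; exact: lt0r_neq0.
  by rewrite subr_ge0 ler_pdivrMr// mul1r; lra.
rewrite /fejer; have [->|a0] := eqVneq a 0.
  rewrite !integral_affine_cst// -EFinD; congr EFin; field.
  exact: lt0r_neq0.
rewrite !integral_affine_cos// -EFinD; congr EFin.
rewrite !mulr0 add0r !mulrN !(cosD, sinD) cosN sinN.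
field.
by rewrite a0 lt0r_neq0.
Qed.

Lemma fejer_ge0 T a : 0 < T -> 0 <= fejer T a.
Proof.
move=> T0; rewrite /fejer; case: ifP => _; first exact: ltW.
apply: divr_ge0; last by rewrite mulr_ge0 ?sqr_ge0// ltW.
by rewrite mulr_ge0// subr_ge0 cos_le1.
Qed.

(** The mean value theorem gives [sin t = cos s * t] with [s] in [0, 1], and cosine decreases
    there. *)
Lemma sin_ge_cos1 t : 0 <= t <= 1 -> cos 1 * t <= sin t.
Proof.
move=> /andP[t0 t1].
have [s|s] := @MVT_segment R sin cos 0 t t0 (fun x _ => is_derive_sin x).
  by apply: continuous_subspaceT; exact: continuous_sin.
rewrite in_itv/= => /andP[s0 st].
rewrite sin0 !subr0 => ->; apply: ler_wpM2r => //.
have pi2 := pi_ge2 R.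
by rewrite leNgt ltr_cos ?in_itv/=; lra.
Qed.

(** With [s = |a * T| / 2], the half-angle formula turns the numerator into [4 * sin s ^+ 2]. As
    [s <= 1], this is at least [4 * (cos 1 * s) ^+ 2], which is [cos 1 ^+ 2 * (a * T) ^+ 2]. *)
Lemma fejer_ge T a : 0 < T -> `|a * T| <= 2 -> cos 1 ^+ 2 * T <= fejer T a.
Proof.
move=> T0 aT; have c0 := cos1_gt0 R.
rewrite /fejer; have [_|a0] := eqVneq a 0.
  rewrite ler_piMl//; exact: ltW.
pose s := `|a * T| / 2.
have s01 : 0 <= s <= 1 by rewrite divr_ge0//= ler_pdivrMr// mul1r.
have cs : cos (a * T) = 1 - sin s ^+ 2 *+ 2.
  rewrite -cos_norm (_ : `|a * T| = s *+ 2); last by rewrite -mulr_natr divfK.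
  by rewrite cos_mulr2n cos2sin2; ring.
rewrite cs ler_pdivlMr; last by rewrite mulr_gt0// exprn_even_gt0.
have -> : cos 1 ^+ 2 * T * (a ^+ 2 * T) = 4 * (cos 1 * s) ^+ 2.
  rewrite (_ : cos 1 ^+ 2 * T * (a ^+ 2 * T) = cos 1 ^+ 2 * (a * T) ^+ 2); last by ring.
  by rewrite -[(a * T) ^+ 2]real_normK ?num_real// /s; field.
rewrite (_ : 2 * _ = 4 * sin s ^+ 2); last by ring.
rewrite ler_pM2l// lerXn2r ?nnegrE ?sin_ge_cos1//.
  by case/andP: s01 => s0 _; rewrite mulr_ge0// ltW.
by apply: le_trans (sin_ge_cos1 s01); case/andP: s01 => s0 _; rewrite mulr_ge0// ltW.
Qed.

End fejer.

Lemma integrable_le_indic d (X : measurableType d) (R : realType)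
    (m : {measure set X -> \bar R}) (B : set X) (f : X -> R) :
  measurable B -> (m B < +oo)%E -> measurable_fun setT f ->
  (forall x, `|f x| <= \1_B x) -> m.-integrable setT (EFin \o f).
Proof.
move=> mB Boo mf fB; apply/integrableP; split; first exact/measurable_EFinP.
apply: le_lt_trans Boo; rewrite -[X in (_ <= m X)%E]setIT -integral_indic//.
apply: ge0_le_integral => //.
- by apply/measurable_EFinP; apply: measurableT_comp.
- by apply/measurable_EFinP; exact: measurable_indic.
- by move=> x _; rewrite lee_fin.
Qed.

(** * Products of tents on R^n and their Fourier transforms *)

Section tentn.
Context {R : realType}.
Implicit Types (T c theta : R) (n : nat).

Definition tentn n T (x : 'rV[R]_n) : R := \prod_(i < n) tent T (x 0 i).

Lemma tentn_ge0 n T (x : 'rV[R]_n) : 0 <= tentn T x.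
Proof. by apply: prodr_ge0 => i _; exact: tent_ge0. Qed.

Lemma tentn_le1 n T (x : 'rV[R]_n) : 0 < T -> tentn T x <= 1.
Proof.
by move=> T0; apply: prodr_ile1 => i _; rewrite tent_ge0 tent_le1.
Qed.

Lemma tentn_eq0 n T (x : 'rV[R]_n) : 0 < T -> ~ ball 0 T x -> tentn T x = 0.
Proof.
move=> T0 xT; apply/eqP/negPn/negP => /prodf_neq0 t0; apply: xT.
apply/ball_rVP => // i; rewrite mxE sub0r normrN ltNge; apply/negP => Tx.
by have := t0 i isT; rewrite tent_eq0// eqxx.
Qed.

Lemma measurable_tentn n T :
  measurable_fun setT (tentn T : borelRn R n -> R).
Proof.
apply: measurable_prod => i _; apply: measurableT_comp.
  by apply: continuous_measurable_fun; exact: continuous_tent.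
exact: measurable_coordRn.
Qed.

Lemma integrable_tentn n T (f : borelRn R n -> R) : 0 < T ->
  measurable_fun setT f -> (forall x, `|f x| <= 1) ->
  (lebesgue_Rn R n).-integrable setT (fun x => (tentn T x * f x)%:E).
Proof.
move=> T0 mf f1; pose B : set (borelRn R n) := ball (0 : 'rV[R]_n) T.
have mB : measurable B by apply: open_measurable_borelRn; exact: ball_open.
apply: (integrable_le_indic mB).
- by have := ltry ((T *+ 2) ^+ n); rewrite -(lebesgue_Rn_ball 0 T0).
- by apply: measurable_funM => //; exact: measurable_tentn.
move=> x; rewrite indicE normrM (ger0_norm (tentn_ge0 _ _)).
have [/set_mem Bx|/negP Bx] := boolP (x \in B).
  by rewrite mulr_ile1// ?tentn_ge0 ?tentn_le1.
by rewrite tentn_eq0 ?mul0r// => xB; apply: Bx; rewrite inE.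
Qed.

Lemma measurable_cos d (X : measurableType d) (f : X -> R) (D : set X) :
  measurable_fun D f -> measurable_fun D (fun x => cos (f x)).
Proof.
move=> mf; apply: (measurableT_comp _ mf).
by apply: continuous_measurable_fun; exact: continuous_cos.
Qed.

Lemma measurable_cos_dotmul n c theta (w : 'rV[R]_n) :
  measurable_fun setT (fun z : borelRn R n => cos (c * dotmul z w + theta)).
Proof.
apply: measurable_cos; apply: measurable_funD => //; apply: measurable_funM => //.
by apply: measurable_dotmul.
Qed.

Lemma dotmul_consRn n (p : measurableTypeR R * borelRn R n) (w : 'rV[R]_n.+1) :
  dotmul (consRn p) w =
  p.1 * w 0 ord0 + dotmul (p.2 : 'rV[R]_n) (\row_i w 0 (lift ord0 i)).
Proof.
rewrite /dotmul big_ord_recl consRn0; congr (_ + _).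
by apply: eq_bigr => i _; rewrite consRn_lift mxE.
Qed.

(** Induction on [n] with [theta] general: for a fixed first coordinate [t], the term
    [c * w 0 ord0 * t] joins the phase of the integral over the other coordinates, and the
    one-dimensional formula then integrates [t]. *)
Lemma integral_tentn_cos n T c theta (w : 'rV[R]_n) : 0 < T ->
  (\int[lebesgue_Rn R n]_z (tentn T z * cos (c * dotmul z w + theta))%:E =
    ((\prod_(i < n) fejer T (c * w 0 i)) * cos theta)%:E)%E.
Proof.
move=> T0; elim: n theta w => [|n IH] theta w.
  rewrite big_ord0 mul1r integral_dirac//=; last first.
    apply/measurable_EFinP; apply: measurable_funM; first exact: measurable_tentn.
    exact: measurable_cos_dotmul.
  by rewrite diracT mul1e /tentn /dotmul !big_ord0 mulr0 mul1r add0r.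
rewrite integral_lebesgue_RnS; last first.
  apply: integrable_tentn => //; first exact: measurable_cos_dotmul.
  by move=> x; exact: cos_max.
pose w' : 'rV[R]_n := \row_i w 0 (lift ord0 i).
pose K := \prod_(i < n) fejer T (c * w' 0 i).
transitivity (\int[lebesgue_measure]_t
    (K%:E * (tent T t * cos (c * w 0 ord0 * t + theta))%:E))%E.
  apply: eq_integral => t _.
  transitivity (\int[lebesgue_Rn R n]_y ((tent T t)%:E *
      (tentn T y * cos (c * dotmul y w' + (c * w 0 ord0 * t + theta)))%:E))%E.
    apply: eq_integral => y _; rewrite -EFinM; congr EFin.
    rewrite dotmul_consRn /tentn big_ord_recl consRn0 /=.
    under eq_bigr do rewrite consRn_lift /=.
    rewrite -!mulrA; congr (_ * (_ * cos _)).
    by rewrite -/w'; ring.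
  rewrite integralZl//; last first.
    apply: integrable_tentn => //; first exact: measurable_cos_dotmul.
    by move=> x; exact: cos_max.
  by rewrite IH -!EFinM; congr EFin; rewrite -/K; ring.
rewrite integralZl//.
  rewrite integral_tent_cos// -EFinM; congr EFin.
  rewrite big_ord_recl /K mulrA; congr (_ * _); rewrite mulrC; congr (_ * _).
  by apply: eq_bigr => i _; rewrite mxE.
have mt : measurable_fun setT (fun t => tent T t * cos (c * w 0 ord0 * t + theta)).
  apply: continuous_measurable_fun => t.
  by apply: cvgM; [exact: continuous_tent|exact: continuous_cos_affine].
apply: (@integrable_le_indic _ _ R lebesgue_measure (ball (0 : R) T)
  (fun t => tent T t * cos (c * w 0 ord0 * t + theta))) => //.
- exact: measurable_ball.
- by have := ltry (T *+ 2); rewrite -(lebesgue_measure_ball 0 (ltW T0)).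
move=> t; rewrite indicE normrM (ger0_norm (tent_ge0 _ _)).
have [/set_mem Bt|/negP Bt] := boolP (t \in _).
  by rewrite mulr_ile1// ?tent_ge0 ?tent_le1 ?cos_max.
rewrite tent_eq0 ?mul0r// leNgt; apply/negP => tT; apply: Bt.
by rewrite inE -ball_normE /ball_/= sub0r normrN.
Qed.

End tentn.

(** * Energy of a finite measure *)

Section bounded_integrals.
Local Open Scope ereal_scope.
Context {R : realType}.

Lemma integrable_le1 d (X : measurableType d) (m : {finite_measure set X -> \bar R})
    (f : X -> R) :
  measurable_fun setT f -> (forall x, (`|f x| <= 1)%R) ->
  m.-integrable setT (EFin \o f).
Proof.
move=> mf f1; apply: (@integrable_le_indic _ _ _ _ setT) => //.
  by rewrite -ge0_fin_numE// fin_num_measure.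
by move=> x; rewrite indicT.
Qed.

Lemma EFin_Rintegral d (X : measurableType d) (m : {finite_measure set X -> \bar R})
    (f : X -> R) :
  measurable_fun setT f -> (forall x, (`|f x| <= 1)%R) ->
  (\int[m]_x f x)%R%:E = \int[m]_x (f x)%:E.
Proof.
by move=> mf f1; rewrite fineK// integrable_fin_num//; exact: integrable_le1.
Qed.

End bounded_integrals.

Section finite_product.
Local Open Scope ereal_scope.
Context {R : realType} {d1 d2 : measure_display}.
Context {X : measurableType d1} {Y : measurableType d2}.
Variables (m1 : {finite_measure set X -> \bar R})
  (m2 : {finite_measure set Y -> \bar R}).

(** The product gets a name of its own so that a finite measure structure can be attached to it. *)
Definition mprod : set (X * Y) -> \bar R := m1 \x m2.

HB.instance Definition _ := Measure.on mprod.

Let mprod_fin : fin_num_fun mprod.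
Proof.
move=> A mA; rewrite ge0_fin_numE//; apply: (@le_lt_trans _ _ (mprod setT)).
  by apply: le_measure; rewrite ?inE.
rewrite /mprod -setXTT product_measure1E//.
by rewrite lte_mul_pinfty// ?fin_num_measure// -ge0_fin_numE// fin_num_measure.
Qed.

HB.instance Definition _ := Measure_isFinite.Build _ _ _ mprod mprod_fin.

Lemma RintegralM (f : X -> R) (g : Y -> R) :
  measurable_fun setT f -> (forall x, (`|f x| <= 1)%R) ->
  measurable_fun setT g -> (forall y, (`|g y| <= 1)%R) ->
  ((\int[m1]_x f x) * (\int[m2]_y g y))%R%:E =
  \int[mprod]_p (f p.1 * g p.2)%:E.
Proof.
move=> mf f1 mg g1.
have mfg : measurable_fun setT (fun p : X * Y => f p.1 * g p.2)%R.
  by apply: measurable_funM; apply: measurableT_comp.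
rewrite /mprod -integral12_prod_meas1/=; last first.
  by apply: (integrable_le1 mprod mfg) => p; rewrite normrM mulr_ile1.
rewrite EFinM (EFin_Rintegral m1 mf f1) -integralZr//; last exact: integrable_le1.
apply: eq_integral => x _; rewrite /fubini_F/= EFin_Rintegral//.
by under [RHS]eq_integral do rewrite EFinM; rewrite integralZl//; exact: integrable_le1.
Qed.

End finite_product.

Section energy.
Context {R : realType} {n : nat}.
Variable nu : {finite_measure set (borelRn R n) -> \bar R}.
Local Notation L := (lebesgue_Rn R n).
Implicit Types z w : 'rV[R]_n.

(** Real part of the Fourier transform of [nu]. It is the whole transform when [nu] is symmetric, as
    for the autocorrelation to which it is applied. *)
Definition cosft z : R := \int[nu]_w cos (2 * pi * dotmul z w).

(* Only [1 + cos] is nonnegative, as Tonelli requires. *)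
Lemma measurable_cosft : measurable_fun setT (cosft : borelRn R n -> R).
Proof.
pose f (p : borelRn R n * borelRn R n) := cos (2 * pi * dotmul (p.1 : 'rV[R]_n) p.2).
have mf : measurable_fun setT f.
  by apply: measurable_cos; apply: measurable_funM => //; exact: measurable_dotmul.
have mfz z : measurable_fun setT (fun w : borelRn R n => cos (2 * pi * dotmul z w)).
  by apply: measurable_cos; apply: measurable_funM => //; exact: measurable_dotmul.
rewrite (_ : cosft = (fun z => fine (fubini_F nu (fun p => (1 + f p)%:E) z) - fine (nu setT))).
  apply: measurable_funB => //; apply: measurableT_comp => //.
  apply: measurable_fun_fubini_tonelli_F.
    by apply/measurable_EFinP; apply: measurable_funD.
  by move=> p; rewrite lee_fin -lerBlDl sub0r cos_geN1.
apply/funext => z; rewrite /fubini_F /f /=.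
under eq_integral do rewrite EFinD.
rewrite integralD//; last 2 first.
- by apply: (@integrable_le1 _ _ _ nu (cst 1)) => // x; rewrite normr1.
- apply: (integrable_le1 nu (mfz z)) => w; exact: cos_max.
rewrite -(EFin_Rintegral nu (mfz z)); last by move=> x; exact: cos_max.
rewrite integral_cst// mul1e fineD ?fin_num_measure//=.
by rewrite addrAC subrr add0r.
Qed.

(** Weighting [cosft z ^+ 2] by [tentn T z <= 1] only decreases its integral. Once the square is
    written as a double integral over [nu] x [nu] and Fubini is applied, the inner integral is a
    Fejer kernel, which is nonnegative everywhere and bounded below when the two points are
    [r]-close. *)
Lemma energy_le T r : 0 < T -> 2 * pi * r * T <= 2 ->
  (((cos 1 ^+ 2 * T) ^+ n / 2)%:E *
   (mprod nu nu) [set p | ball (p.1 : 'rV[R]_n) r (p.2 : 'rV[R]_n)] <=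
   \int[L]_z (cosft z ^+ 2)%:E)%E.
Proof.
move=> T0 rT.
pose H (q : borelRn R n * (borelRn R n * borelRn R n)) : R :=
  tentn T q.1 * (cos (2 * pi * dotmul (q.1 : 'rV[R]_n) q.2.1) *
    cos (2 * pi * dotmul (q.1 : 'rV[R]_n) q.2.2)).
have mH : measurable_fun setT H.
  apply: measurable_funM; first by apply: measurableT_comp => //; exact: measurable_tentn.
  apply: measurable_funM; apply: measurable_cos; apply: measurable_funM => //;
    apply: measurable_dotmul => //; exact: measurableT_comp.
have iH : (L \x (mprod nu nu))%E.-integrable setT (EFin \o H).
  pose B : set (borelRn R n) := ball (0 : 'rV[R]_n) T.
  have mB : measurable B by apply: open_measurable_borelRn; exact: ball_open.
  apply: (@integrable_le_indic _ _ R (L \x mprod nu nu)%E (B `*` setT) H) => //.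
  - exact: measurableX.
  - rewrite [X in (X < _)%E](_ : _ = (L B * mprod nu nu setT)%E); last first.
      exact: product_measure1E.
    rewrite lte_mul_pinfty//.
      by have := ltry ((T *+ 2) ^+ n); rewrite -(lebesgue_Rn_ball 0 T0) -ge0_fin_numE.
    by rewrite -ge0_fin_numE// fin_num_measure.
  move=> [z p]; rewrite indicE /H /= !normrM (ger0_norm (tentn_ge0 _ _)).
  have [/set_mem []/= Bz _|/negP Bz] := boolP (_ \in _).
    by rewrite !mulr_ile1// ?mulr_ge0 ?tentn_ge0 ?tentn_le1 ?cos_max.
  rewrite tentn_eq0 ?mul0r// => zB; apply: Bz; rewrite inE; split => //.
have mc w : measurable_fun setT (fun z : borelRn R n => cos (2 * pi * dotmul z w)).
  by have := measurable_cos_dotmul (2 * pi) 0 w; under eq_fun do rewrite addr0.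
have mc' z : measurable_fun setT (fun w : borelRn R n => cos (2 * pi * dotmul z w)).
  by apply: measurable_cos; apply: measurable_funM => //; exact: measurable_dotmul.
have HF z : (\int[mprod nu nu]_p (H (z, p))%:E = (tentn T z * cosft z ^+ 2)%:E)%E.
  under eq_integral do rewrite /H /= EFinM.
  have c1 w : `|cos (2 * pi * dotmul z w)| <= 1 by exact: cos_max.
  rewrite integralZl//=; last first.
    apply: (@integrable_le1 _ _ _ (mprod nu nu) (fun p =>
      cos (2 * pi * dotmul z p.1) * cos (2 * pi * dotmul z p.2))).
      by apply: measurable_funM;
        [apply: (measurableT_comp (mc' z))|apply: (measurableT_comp (mc' z))].
    by move=> p; rewrite normrM mulr_ile1.
  by rewrite -(RintegralM nu nu (mc' z) c1 (mc' z) c1) -EFinM.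
have HL : (\int[mprod nu nu]_p \int[L]_z (H (z, p))%:E <= \int[L]_z (cosft z ^+ 2)%:E)%E.
  rewrite -(Fubini iH); apply: ge0_le_integral => //.
  - by move=> z _; rewrite /= HF lee_fin mulr_ge0 ?tentn_ge0 ?sqr_ge0.
  - exact: measurable_fubini_F iH.
  - by apply/measurable_EFinP; apply: measurable_funX; exact: measurable_cosft.
  - by move=> z _; rewrite /= HF lee_fin ler_piMl ?sqr_ge0 ?tentn_le1.
apply: le_trans HL.
(* 2 cos a cos b = cos (a - b) + cos (a + b), and both terms integrate to
   nonnegative kernels, so the second one can be dropped. *)
pose K w := \prod_(i < n) fejer T (2 * pi * w 0 i).
have K0 w : 0 <= K w by apply: prodr_ge0 => i _; exact: fejer_ge0.
have HG (p : borelRn R n * borelRn R n) : (\int[L]_z (H (z, p))%:E =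
    ((K ((p.1 : 'rV[R]_n) - p.2) + K ((p.1 : 'rV[R]_n) + p.2)) / 2)%:E)%E.
  transitivity (\int[L]_z ((2^-1)%:E *
      ((tentn T z * cos (2 * pi * dotmul z ((p.1 : 'rV[R]_n) - p.2) + 0))%:E +
       (tentn T z * cos (2 * pi * dotmul z ((p.1 : 'rV[R]_n) + p.2) + 0))%:E)))%E.
    apply: eq_integral => z _; rewrite -EFinD -EFinM; congr EFin.
    rewrite /H /= !addr0 dotmulBr dotmulDr (mulrBr (2 * pi)) (mulrDr (2 * pi)) cosB cosD.
    by field.
  have ic w : L.-integrable setT (fun z =>
      (tentn T z * cos (2 * pi * dotmul z w + 0))%:E).
    apply: integrable_tentn => //; first exact: measurable_cos_dotmul.
    by move=> x; exact: cos_max.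
  rewrite integralZl//; last exact: integrableD.
  by rewrite integralD// !integral_tentn_cos// -EFinD -EFinM cos0 !mulr1 mulrC.
pose D := [set p : borelRn R n * borelRn R n | ball (p.1 : 'rV[R]_n) r (p.2 : 'rV[R]_n)].
have mD : measurable D by exact: measurable_ball_rV.
have c0 : 0 <= (cos 1 ^+ 2 * T) ^+ n / 2 :> R.
  by rewrite divr_ge0// exprn_ge0// mulr_ge0 ?sqr_ge0// ltW.
rewrite -/D -[X in (_ * mprod _ _ X)%E]setIT -integral_indic//.
rewrite -ge0_integralZl//; last first.
  by apply/measurable_EFinP; exact: measurable_indic.
apply: ge0_le_integral => //.
- by move=> p _; rewrite mule_ge0.
- by apply: emeasurable_funM => //; apply/measurable_EFinP; exact: measurable_indic.
- exact: measurable_fubini_G iH.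
move=> p _; rewrite HG indicE -EFinM lee_fin.
have [/set_mem Dp|_] := boolP (p \in D); last first.
  by rewrite mulr0 divr_ge0// addr_ge0.
rewrite mulr1 ler_wpM2r// -[leLHS]addr0 lerD//.
(* On [D] each coordinate of the difference is below [r], so [2 * pi * r * T <= 2] puts every factor
   within the range of [fejer_ge]. *)
rewrite -[n in leLHS]card_ord -prodr_const; apply: ler_prod => i _.
apply/andP; split; first by rewrite mulr_ge0 ?sqr_ge0// ltW.
apply: fejer_ge => //; rewrite !mxE.
have pi0 := pi_gt0 R.
apply: le_trans rT; rewrite normrM (gtr0_norm T0) ler_pM2r//.
rewrite normrM gtr0_norm ?mulr_gt0// ler_pM2l ?mulr_gt0//.
by case: Dp => _ /(_ 0 i) /ltW.
Qed.

(** The energy bound is used with [r = 2e] and [T = 1 / (2 * pi * e)], the largest [T] allowed by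
    [2 * pi * r * T <= 2]. *)
Lemma near_diagonal_le : (\int[L]_z (cosft z ^+ 2)%:E < +oo)%E ->
  exists C : R, forall e, 0 < e ->
    (mprod nu nu [set p | ball (p.1 : 'rV[R]_n) (e *+ 2) (p.2 : 'rV[R]_n)] <=
      (C * (e *+ 2) ^+ n)%:E)%E.
Proof.
set M := (\int[L]_z _)%E => Moo.
have M0 : (0 <= M)%E by apply: integral_ge0 => z _; rewrite lee_fin sqr_ge0.
have pi0 := pi_gt0 R; have c0 := cos1_gt0 R.
(* Dividing [M] by [(cos 1 ^+ 2 * T) ^+ n / 2] leaves [2 * M * (2 * pi * e / cos 1 ^+ 2) ^+ n], from
   which the factor [(e *+ 2) ^+ n] is split off. *)
exists (2 * fine M * (pi / cos 1 ^+ 2) ^+ n) => e e0.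
have [pin en cn] : [/\ pi != 0 :> R, e != 0 & cos 1 != 0 :> R].
  by split; exact: lt0r_neq0.
have T0 : 0 < (2 * pi * e)^-1 by rewrite invr_gt0 !mulr_gt0.
have rT : 2 * pi * (e *+ 2) * (2 * pi * e)^-1 <= 2.
  by move: (@pi R) pin => p p0; rewrite le_eqVlt; apply/orP; left; apply/eqP;
    field; rewrite p0 en.
have := energy_le T0 rT; rewrite -/M -[M]fineK ?ge0_fin_numE//.
set P := mprod nu nu _.
have Pfin : P \is a fin_num.
  by apply: fin_num_measure; exact: measurable_ball_rV.
rewrite -(fineK Pfin) -EFinM !lee_fin; set p := fine P => ineq.
have a0 : 0 < (cos 1 ^+ 2 * (2 * pi * e)^-1) ^+ n / 2.
  by rewrite divr_gt0// exprn_gt0// mulr_gt0// exprn_gt0.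
rewrite -(ler_pM2l a0); apply: (le_trans ineq).
rewrite le_eqVlt; apply/orP; left; apply/eqP.
transitivity (fine M * (cos 1 ^+ 2 * (2 * pi * e)^-1 * (pi / cos 1 ^+ 2) * (e *+ 2)) ^+ n).
  rewrite (_ : _ * (e *+ 2) = 1) ?expr1n ?mulr1//.
  by move: (@pi R) pin => q q0; field; rewrite q0 en cn.
by rewrite !exprMn; field.
Qed.

End energy.

(** * Absolute continuity *)

Section sections.
Local Open Scope ereal_scope.
Context {R : realType} {d1 d2 : measure_display}.
Context {X : measurableType d1} {Y : measurableType d2}.
Variables (m1 : {sigma_finite_measure set X -> \bar R})
  (m2 : {sigma_finite_measure set Y -> \bar R}).

Lemma integral_sections (E : set (X * Y)) : measurable E ->
  \int[m1]_x m2 [set y | E (x, y)] = \int[m2]_y m1 [set x | E (x, y)].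
Proof.
move=> mE; have := indic_fubini_tonelli m1 m2 mE.
rewrite indic_fubini_tonelli_FE// indic_fubini_tonelli_GE//.
have -> : m2 \o xsection E = (fun x => m2 [set y | E (x, y)]).
  by apply/funext => x /=; congr (m2 _); apply/seteqP; split=> y;
    rewrite /xsection/= inE.
have -> // : m1 \o ysection E = (fun y => m1 [set x | E (x, y)]).
by apply/funext => y /=; congr (m1 _); apply/seteqP; split=> x;
  rewrite /ysection/= inE.
Qed.

Lemma measurable_sections1 (E : set (X * Y)) : measurable E ->
  measurable_fun setT (fun x => m2 [set y | E (x, y)]).
Proof.
move=> mE; rewrite (_ : (fun x => _) = m2 \o xsection E).
  exact: measurable_fun_xsection.
by apply/funext => x /=; congr (m2 _); apply/seteqP; split=> y;
  rewrite /xsection/= inE.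
Qed.

Lemma measurable_sections2 (E : set (X * Y)) : measurable E ->
  measurable_fun setT (fun y => m1 [set x | E (x, y)]).
Proof.
move=> mE; rewrite (_ : (fun y => _) = m1 \o ysection E).
  exact: measurable_fun_ysection.
by apply/funext => y /=; congr (m1 _); apply/seteqP; split=> x;
  rewrite /ysection/= inE.
Qed.

End sections.

Section absolute_continuity.
Context {R : realType} {n : nat}.
Variable nu : {finite_measure set (borelRn R n) -> \bar R}.
Local Notation L := (lebesgue_Rn R n).
Variable C : R.
Hypothesis nuC : forall e, 0 < e ->
  (mprod nu nu [set p | ball (p.1 : 'rV[R]_n) (e *+ 2) (p.2 : 'rV[R]_n)] <=
    (C * (e *+ 2) ^+ n)%:E)%E.

Definition thicken (A : set 'rV[R]_n) (e : R) : set 'rV[R]_n :=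
  \bigcup_(a in A) ball a e.

Lemma open_thicken A e : open (thicken A e).
Proof. by apply: bigcup_open => a _; exact: ball_open. Qed.

(** Spread each point of [A] over the cube of radius [e] around it: [V * nu A] becomes an integral
    over the thickening, bounded by that of [nu (ball x e)], whose L^2 norm is controlled by [nuC].
    The free parameter [t] balances volume against energy. *)
Lemma measure_le_thicken (A : set (borelRn R n)) (e t : R) :
  measurable A -> 0 < e -> 0 < t ->
  (nu A <= (t / 2)%:E * L (thicken A e) + (C / (2 * t))%:E)%E.
Proof.
move=> mA e0 t0; pose V := (e *+ 2) ^+ n.
have V0 : 0 < V by rewrite exprn_gt0// mulrn_wgt0.
have mT : measurable (thicken A e : set (borelRn R n)).
  by apply: open_measurable_borelRn; exact: open_thicken.
have LV (x : 'rV[R]_n) : L (ball x e) = V%:E by exact: lebesgue_Rn_ball.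
have mball (x : 'rV[R]_n) : measurable (ball x e : set (borelRn R n)).
  by apply: open_measurable_borelRn; exact: ball_open.
pose E1 : set (borelRn R n * borelRn R n) :=
  [set p | A p.1 /\ ball (p.2 : 'rV[R]_n) e (p.1 : 'rV[R]_n)].
have mE1 : measurable E1.
  rewrite (_ : E1 = (A `*` setT) `&`
      [set p | ball (p.2 : 'rV[R]_n) e (p.1 : 'rV[R]_n)]).
    apply: measurableI; first exact: measurableX.
    by apply: measurable_ball_rV.
  by apply/seteqP; split=> [p []|p [[]]].
pose E2 : set (borelRn R n * (borelRn R n * borelRn R n)) :=
  [set q | ball (q.1 : 'rV[R]_n) e (q.2.1 : 'rV[R]_n) /\
           ball (q.1 : 'rV[R]_n) e (q.2.2 : 'rV[R]_n)].
have mE2 : measurable E2.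
  apply: measurableI; apply: measurable_ball_rV; try exact: measurable_fst.
    exact: (measurableT_comp measurable_fst measurable_snd).
  exact: (measurableT_comp measurable_snd measurable_snd).
(* Tonelli on the pairs of a point of [A] and a point [e]-close to it. *)
have H1 : (V%:E * nu A = \int[L]_x nu [set w | E1 (w, x)])%E.
  rewrite -(integral_sections nu L mE1).
  rewrite -[X in (_ * nu X)%E]setIT -integral_indic// -ge0_integralZl//; last 2 first.
  - by apply/measurable_EFinP; exact: measurable_indic.
  - by rewrite lee_fin ltW.
  apply: eq_integral => w _; rewrite indicE /E1.
  have [/set_mem Aw|/negP Aw] := boolP (w \in A).
    rewrite mule1 -(LV w); congr (L _); apply/seteqP; split=> x /=.
      by move=> wx; split=> //; exact: ball_sym.
    by case=> _; exact: ball_sym.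
  rewrite mule0 (_ : [set y | _] = set0) ?measure0//.
  by apply/seteqP; split=> x //= -[+ _]; rewrite -in_setE.
(* The square is the [nu] x [nu] mass of pairs lying in a common ball. Such pairs are [2e]-close,
   and the possible centres fill a volume of at most [V]; [nuC] supplies the remaining factor
   [C * V]. *)
have H2 : (\int[L]_x ((nu (ball (x : 'rV[R]_n) e)) ^+ 2) <= (C * V ^+ 2)%:E)%E.
  have -> : (\int[L]_x ((nu (ball (x : 'rV[R]_n) e)) ^+ 2) =
      \int[L]_x mprod nu nu [set p | E2 (x, p)])%E.
    apply: eq_integral => x _.
    transitivity (nu (ball (x : 'rV[R]_n) e) * nu (ball (x : 'rV[R]_n) e))%E => //.
    by rewrite -product_measure1E//.
  rewrite (integral_sections L (mprod nu nu) mE2).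
  pose D := [set p : borelRn R n * borelRn R n |
    ball (p.1 : 'rV[R]_n) (e *+ 2) (p.2 : 'rV[R]_n)].
  have mD : measurable D by exact: measurable_ball_rV.
  apply: (@le_trans _ _ (V%:E * mprod nu nu D)%E); last first.
    rewrite expr2 mulrA [X in (_ <= X)%E]EFinM muleC.
    by apply: lee_wpmul2r; [rewrite lee_fin ltW|exact: nuC].
  rewrite -[X in (_ * mprod _ _ X)%E]setIT -integral_indic// -ge0_integralZl//; last 2 first.
  - by apply/measurable_EFinP; exact: measurable_indic.
  - by rewrite lee_fin ltW.
  apply: ge0_le_integral => //.
  - exact: measurable_sections2.
  - by apply: emeasurable_funM => //; apply/measurable_EFinP; exact: measurable_indic.
  move=> p _; rewrite indicE.
  have [/set_mem Dp|/negP Dp] := boolP (p \in D).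
    rewrite mule1 -(LV p.1); apply: le_measure; rewrite ?inE//.
      have := measurable_ysection p mE2.
      by congr measurable; apply/seteqP; split=> x; rewrite /ysection/= inE.
    by move=> x [/ball_sym].
  rewrite (_ : [set x | _] = set0) ?measure0 ?mule0//.
  apply/seteqP; split=> x //= -[] /= xp1 xp2; apply: Dp; rewrite inE.
  by have := ball_triangle (ball_sym xp1) xp2; rewrite -mulr2n.
have mh : measurable_fun setT (fun x : borelRn R n => nu (ball (x : 'rV[R]_n) e)).
  pose E3 : set (borelRn R n * borelRn R n) :=
    [set p | ball (p.1 : 'rV[R]_n) e (p.2 : 'rV[R]_n)].
  have mE3 : measurable E3 by exact: measurable_ball_rV.
  exact: (measurable_sections1 nu mE3).
have mh2 : measurable_fun setT
    (fun x : borelRn R n => ((2 * V * t)^-1%:E * (nu (ball (x : 'rV[R]_n) e)) ^+ 2)%E).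
  by apply: emeasurable_funM => //; apply: emeasurable_funM.
have mg : measurable_fun setT
    (fun x : borelRn R n => ((V * t / 2)%:E * (\1_(thicken A e : set (borelRn R n)) x)%:E)%E).
  by apply: emeasurable_funM => //; apply/measurable_EFinP; exact: measurable_indic.
have Vt0 : 0 < V * t by rewrite mulr_gt0.
have g0 (x : borelRn R n) :
    (0 <= (V * t / 2)%:E * (\1_(thicken A e : set (borelRn R n)) x)%:E)%E.
  by rewrite mule_ge0// lee_fin divr_ge0// ltW.
have h0 (x : borelRn R n) :
    (0 <= ((2 * V * t)^-1)%:E * (nu (ball (x : 'rV[R]_n) e)) ^+ 2)%E.
  by rewrite mule_ge0// ?mule_ge0// lee_fin invr_ge0 -mulrA mulr_ge0// ltW.
(* Young: [y <= V t / 2 + y ^ 2 / (2 V t)] with [y = nu (ball x e)]. *)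
have H3 : (V%:E * nu A <= \int[L]_x (((V * t / 2)%:E *
      (\1_(thicken A e : set (borelRn R n)) x)%:E) +
    ((2 * V * t)^-1)%:E * (nu (ball (x : 'rV[R]_n) e)) ^+ 2))%E.
  rewrite H1; apply: ge0_le_integral => //.
  - exact: (measurable_sections2 nu mE1).
  - exact: emeasurable_funD.
  move=> x _.
  have [xA|/negP xA] := boolP (x \in (thicken A e : set (borelRn R n))); last first.
    rewrite [X in nu X](_ : _ = set0); last first.
      apply/seteqP; split=> w //= -[/= Aw xw]; apply: xA; rewrite inE.
      by exists w => //; exact: ball_sym.
    by rewrite measure0 adde_ge0.
  rewrite indicE xA mule1.
  apply: (@le_trans _ _ (nu (ball (x : 'rV[R]_n) e))).
    apply: le_measure; rewrite ?inE//.
      have := measurable_ysection x mE1.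
      by congr measurable; apply/seteqP; split=> w; rewrite /ysection/= inE.
    by move=> w [].
  have : nu (ball (x : 'rV[R]_n) e) \is a fin_num by rewrite fin_num_measure.
  move=> /fineK <-; set y := fine _.
  rewrite -EFin_expe -EFinM -EFinD lee_fin.
  rewrite -subr_ge0 (_ : _ - _ = (V * t - y) ^+ 2 / (2 * (V * t))).
    by rewrite divr_ge0 ?sqr_ge0// mulr_ge0// ltW.
  by field; rewrite !gt_eqF.
have H4 : (V%:E * nu A <= (V * t / 2)%:E * L (thicken A e) +
   ((2 * V * t)^-1)%:E * (C * V ^+ 2)%:E)%E.
  apply: (le_trans H3); rewrite ge0_integralD//; apply: leeD.
    rewrite ge0_integralZl//.
    - by rewrite integral_indic// setIT.
    - by apply/measurable_EFinP; exact: measurable_indic.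
    - by rewrite lee_fin divr_ge0// ltW.
  rewrite ge0_integralZl//.
  - by apply: lee_wpmul2l => //; rewrite lee_fin invr_ge0 -mulrA mulr_ge0// ltW.
  - by apply: emeasurable_funM.
  - by move=> x _; rewrite mule_ge0.
  - by rewrite lee_fin invr_ge0 -mulrA mulr_ge0// ltW.
rewrite -(@lee_pmul2l _ V%:E)// ?lte_fin//.
apply: (le_trans H4).
rewrite muleDr//; last exact: fin_num_adde_defl.
rewrite muleA -!EFinM (mulrA V t).
rewrite (_ : (2 * V * t)^-1 * (C * V ^+ 2) = V * (C / (2 * t)))//.
by field; rewrite !gt_eqF.
Qed.

Lemma bigcap_thicken (A : set 'rV[R]_n) : closed A ->
  \bigcap_k thicken A k.+1%:R^-1 = A.
Proof.
move=> cA; apply/seteqP; split=> [x Ax|x Ax k _]; last first.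
  by exists x => //; apply: ballxx; rewrite invr_gt0.
rewrite ((closure_id A).1 cA) => B /nbhs_ballP[e /= e0 eB].
have [k] := ltr_add_invr e0; rewrite add0r => ke.
have [a Aa ax] := Ax k I; exists a; split=> //; apply: eB.
by apply: ball_sym; apply: le_ball ax; exact: ltW.
Qed.

(** The thickenings decrease to the closed set [A], and boundedness gives them finite volume, so
    their volumes tend to [L A = 0]. The previous estimate with a large fixed [t] then rules out
    [nu A > 0]. *)
Lemma null_compact (A : set 'rV[R]_n) : closed A -> bounded_set A ->
  L A = 0%E -> nu A = 0%E.
Proof.
move=> cA bA LA0.
have mA : measurable (A : set (borelRn R n)) by exact: closed_measurable_borelRn.
pose F k : set (borelRn R n) := thicken A k.+1%:R^-1.
have mF k : measurable (F k).
  by apply: open_measurable_borelRn; exact: open_thicken.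
have [r [r0 Ar]] : exists r, 0 < r /\ F 0%N `<=` ball (0 : 'rV[R]_n) r.
  (* Boundedness only gives norm bounds strictly above [M], hence [|M| + 1]. One more unit makes the
     inequality strict, and the last is the radius of the thickening [F 0]. *)
  have [M [_ AM]] := bA; exists (`|M| + 2 + 1); split.
    by rewrite addr_gt0// ltr_pwDr.
  move=> x [a Aa ax]; apply: (@ball_triangle _ _ a).
    rewrite mx_norm_ball /ball_/= sub0r normrN.
    apply: (le_lt_trans (AM (`|M| + 1) _ _ Aa)); last by rewrite ltrD2l ltr1n.
    by rewrite ltr_pwDr// ler_norm.
  by move: ax; rewrite invr1.
have LF : L (F k) @[k --> \oo] --> 0%E.
  rewrite -LA0 -(bigcap_thicken cA); apply: nonincreasing_cvg_mu => //.
  - apply: (@le_lt_trans _ _ (L (ball (0 : 'rV[R]_n) r))).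
      apply: le_measure; rewrite ?inE//.
      by apply: open_measurable_borelRn; exact: ball_open.
    by have := ltry ((r *+ 2) ^+ n); rewrite -(lebesgue_Rn_ball 0 r0).
  - exact: bigcapT_measurable.
  - move=> k l kl; apply/subsetPset => x [a Aa ax]; exists a => //.
    by apply: le_ball ax; rewrite lef_pV2 ?posrE// ler_nat.
apply/eqP/negPn/negP => nuA0.
have nuAfin : nu A \is a fin_num by rewrite fin_num_measure.
pose a := fine (nu A).
have a0 : 0 < a by rewrite fine_gt0// lt0e nuA0 measure_ge0 -ge0_fin_numE.
(* This [t] makes [C / (2 * t)] at most [a / 2], while a volume below [a / t] makes the other term
   less than [a / 2]. The [+ 1] keeps [t] positive when [C] is 0. *)
pose t := (`|C| + 1) / a.
have C1 : 0 < `|C| + 1 by rewrite ltr_pwDr.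
have t0 : 0 < t by rewrite divr_gt0.
have e0 : (0 < (a / t)%:E)%E by rewrite lte_fin divr_gt0.
have [k _ /(_ k (leqnn k)) /= LFk] := LF _ (open_ereal_lt' e0).
have k0 : 0 < k.+1%:R^-1 :> R by rewrite invr_gt0.
have := measure_le_thicken mA k0 t0; apply/negP; rewrite -ltNge.
apply: (@lt_le_trans _ _ ((t / 2)%:E * (a / t)%:E + (C / (2 * t))%:E)%E).
  rewrite lte_leD//.
  by rewrite lte_pmul2l// lte_fin divr_gt0.
rewrite -(fineK nuAfin) -/a -EFinM -EFinD lee_fin.
have -> : t / 2 * (a / t) = a / 2 by field; rewrite gt_eqF.
rewrite [leRHS]splitr lerD2l.
apply: (@le_trans _ _ ((`|C| + 1) / (2 * t))).
  apply: ler_wpM2r; first by rewrite invr_ge0 mulr_ge0 ?(ltW t0).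
  by rewrite (le_trans (ler_norm _)) ?lerDl.
by rewrite le_eqVlt; apply/orP; left; apply/eqP; rewrite /t; field; rewrite !gt_eqF.
Qed.

End absolute_continuity.

(** * Null sets of radii *)

Section expanding.
Context {R : realType}.
Local Notation leb := (@lebesgue_measure R).

Lemma lebesgue_measure_diam (A : set R) (r : R) : 0 <= r ->
  (forall s t, A s -> A t -> `|s - t| <= r) -> (leb A <= (r *+ 2)%:E)%E.
Proof.
move=> r0 Ar; have [->|/set0P[s As]] := eqVneq A set0.
  by rewrite measure0 lee_fin mulrn_wge0.
apply: (@le_trans _ _ (leb `[s - r, s + r])).
  apply: le_outer_measure => t At; rewrite /= in_itv/= -ler_distlC.
  by rewrite distrC Ar.
rewrite lebesgue_measure_itv/=; case: ifP => _; last by rewrite lee_fin mulrn_wge0.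
by rewrite -EFinB lee_fin le_eqVlt; apply/orP; left; apply/eqP; ring.
Qed.

(** Cover [E] by intervals of small total length. Expansion by [k] bounds the diameter of each
    preimage within [U] by the length over [k]. Outer measure is used throughout, since these
    preimages need not be measurable. *)
Lemma expanding_null (g : R -> R) (U E : set R) (k : R) : 0 < k ->
  (forall s t, U s -> U t -> k * `|s - t| <= `|g s - g t|) ->
  leb E = 0%E -> leb.-negligible (U `&` g @^-1` E).
Proof.
move=> k0 gU E0; apply/negligible_outer_measure.
suff: (leb (U `&` g @^-1` E) <= 0)%E.
  by move=> h; apply/eqP; rewrite eq_le h outer_measure_ge0.
apply/lee_addgt0Pr => e e0; rewrite add0e.
(* The diameter bound for measures costs a factor 2 and the expansion a factor [1 / k], so length
   [k * e / 2] yields [e]. *)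
have ek0 : (0 < (k * e / 2)%:E)%E by rewrite lte_fin divr_gt0// mulr_gt0.
have : (leb E < (k * e / 2)%:E)%E by rewrite E0.
move=> /ereal_inf_lt[z [/= M covM sM] zke].
apply: (@le_trans _ _ (\sum_(i <oo) leb (U `&` g @^-1` (M i)))%E).
  apply: (@le_trans _ _ (leb (\bigcup_i (U `&` g @^-1` (M i))))).
    apply: le_outer_measure => t [Ut Et].
    by have [i _ Mi] := cover_subset covM Et; exists i.
  exact: outer_measure_sigma_subadditive.
apply: (@le_trans _ _ (\sum_(i <oo) (2 / k)%:E * wlength idfun (M i))%E).
  apply: lee_nneseries => // i _.
  have /ocitvP[->|[[a b] /= ab ->]] : ocitv (M i) by exact: (cover_measurable covM).
    by rewrite preimage_set0 setI0 !measure0 mule0.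
  rewrite wlength_itv/= lte_fin ab -EFinB -EFinM.
  have -> : 2 / k * (b - a) = ((b - a) / k) *+ 2 by field; rewrite gt_eqF.
  apply: lebesgue_measure_diam.
    by rewrite divr_ge0 ?(ltW k0)// subr_ge0 ltW.
  move=> s t [Us +] [Ut]; rewrite /= !in_itv/= => gs gt.
  rewrite ler_pdivlMr// mulrC (le_trans (gU _ _ Us Ut))// ler_norml.
  by apply/andP; split; lra.
rewrite nneseriesZl// sM (_ : e%:E = (2 / k)%:E * (k * e / 2)%:E)%E.
  by rewrite lee_pmul2l// ?lte_fin ?divr_gt0// ltW.
by rewrite -EFinM; congr EFin; field; rewrite gt_eqF.
Qed.

(* [t |-> sqrt (t ^ 2 + c)] is expanding on each of the two pieces
   [1 / (k + 1) <= +-t <= k + 1], and these cover R minus 0. *)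
Lemma sqrt_preimage_null (c : R) (E : set R) : 0 <= c -> measurable E ->
  leb E = 0%E -> leb [set t | E (Num.sqrt (t ^+ 2 + c))] = 0%E.
Proof.
move=> c0 mE E0; pose g (t : R) := Num.sqrt (t ^+ 2 + c).
pose U (s : bool) (k : nat) := [set t : R | k.+1%:R^-1 <= (-1) ^+ s * t <= k.+1%:R].
have negU s k : leb.-negligible (U s k `&` g @^-1` E).
  pose b : R := Num.sqrt (k.+1%:R ^+ 2 + c).
  have b0 : 0 < b by rewrite sqrtr_gt0 ltr_wpDr// exprn_gt0.
  (* As [g x - g y = (x - y) * (x + y) / (g x + g y)], the rate is [|x + y| / (g x + g y)]: the
     numerator is at least [2 / (k + 1)] because [x] and [y] have the same sign, and the denominator
     is at most [2 * b]. *)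
  apply: (@expanding_null _ _ _ (k.+1%:R^-1 / b)) => //.
    by rewrite divr_gt0// invr_gt0.
  move=> x y /andP[x1 x2] /andP[y1 y2].
  have sq (t : R) : g t ^+ 2 = t ^+ 2 + c.
    by rewrite sqr_sqrtr// addr_ge0// sqr_ge0.
  have gb (t : R) : (-1) ^+ s * t <= k.+1%:R -> k.+1%:R^-1 <= (-1) ^+ s * t ->
      0 < g t <= b.
    move=> t2 t1; have t0 : 0 < ((-1) ^+ s * t) by rewrite (lt_le_trans _ t1)// invr_gt0.
    have tE : t ^+ 2 = ((-1) ^+ s * t) ^+ 2 by rewrite exprMn sqrr_sign mul1r.
    apply/andP; split; first by rewrite sqrtr_gt0 ltr_wpDr// tE exprn_gt0.
    by rewrite ler_wsqrtr// lerD2r tE lerXn2r// nnegrE ltW.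
  have /andP[gx0 gxb] := gb _ x2 x1; have /andP[gy0 gyb] := gb _ y2 y1.
  have gD0 : 0 < g x + g y by rewrite addr_gt0.
  have -> : g x - g y = (x - y) * (x + y) / (g x + g y).
    have E1 : (g x - g y) * (g x + g y) = (x - y) * (x + y).
      by rewrite -!subr_sqr !sq; ring.
    by rewrite -E1 mulfK// gt_eqF.
  rewrite !normrM mulrC -mulrA ler_wpM2l// normfV (gtr0_norm gD0).
  have xy : k.+1%:R^-1 *+ 2 <= `|x + y|.
    have -> : `|x + y| = `|(-1) ^+ s * (x + y)| by rewrite normrMsign.
    by apply: le_trans (ler_norm _); rewrite mulrDr mulr2n lerD.
  apply: (@le_trans _ _ ((k.+1%:R^-1 *+ 2) / (g x + g y))).
    rewrite ler_pdivrMr// mulrAC ler_pdivlMr// mulrnAl -mulrnAr.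
    by rewrite ler_wpM2l ?invr_ge0//; lra.
  by rewrite ler_wpM2r// invr_ge0 ltW.
have neg : leb.-negligible [set t | E (g t)].
  (* Every piece keeps away from the origin, which is added as a single null point. *)
  have : leb.-negligible ([set 0] `|` \bigcup_k
      ((U false k `&` g @^-1` E) `|` (U true k `&` g @^-1` E))).
    apply: negligibleU.
      by apply/negligibleP => //; exact: lebesgue_measure_set1.
    by apply: negligible_bigcup => k; apply: negligibleU.
  apply: negligibleS.
  move=> t Et; have [->|t0] := eqVneq t 0; [by left|right].
  have nt0 : 0 < `|t| by rewrite normr_gt0.
  have [k1] := ltr_add_invr nt0; rewrite add0r => k1t.
  pose k := maxn k1 (Num.truncn `|t|); exists k => //.
  have tk : k.+1%:R^-1 <= `|t| <= k.+1%:R.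
    apply/andP; split.
      by rewrite (le_trans _ (ltW k1t))// lef_pV2 ?posrE// ler_nat ltnS leq_maxl.
    by rewrite (le_trans (ltW (truncnS_gt _)))// ler_nat ltnS leq_maxr.
  have [tp|tn] := ltP 0 t.
    by left; split=> //; rewrite /U /= expr0 mul1r -{1 2}(gtr0_norm tp).
  by right; split=> //; rewrite /U /= expr1 mulN1r -(ler0_norm tn).
apply/negligibleP => //.
have mg : measurable_fun setT g.
  apply: continuous_measurable_fun => t.
  apply: (@continuous_comp _ _ _ (fun t : R => t ^+ 2 + c) Num.sqrt).
    by apply: cvgD; [exact: exprn_continuous|exact: cvg_cst].
  exact: sqrt_continuous.
by have := mg measurableT E mE; rewrite setTI.
Qed.

(** Along a line parallel to the first axis the norm is [sqrt (t ^ 2 + c)], with [c] the squared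
    norm of the other coordinates. Dimension 0 must be excluded: there the only point has mass 1 and
    norm 0. *)
Lemma enorm_preimage_null n (E : set R) : measurable E -> leb E = 0%E ->
  lebesgue_Rn R n.+1 [set x | E (enorm (x : 'rV[R]_n.+1))] = 0%E.
Proof.
move=> mE E0; apply: lebesgue_RnS_null.
  have me := continuous_measurable_borelRn (@continuous_enorm R n.+1).
  by have := me measurableT E mE; rewrite setTI.
move=> y; rewrite -(@sqrt_preimage_null (dotmul (y : 'rV[R]_n) y) E)//; last exact: dotmul_ge0.
congr (leb _); apply/seteqP; split=> t /=; rewrite /enorm;
  rewrite dotmul_consRn consRn0 -expr2 /=;
  rewrite (_ : \row_i _ = y) //; apply/rowP => i; rewrite mxE consRn_lift//.
Qed.

End expanding.

(** * Autocorrelation and support *)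

Section autocorrelation.
Context {R : realType} {n : nat}.
Variable mu : {finite_measure set (borelRn R n) -> \bar R}.

Definition subRn (p : borelRn R n * borelRn R n) : borelRn R n :=
  (p.1 : 'rV[R]_n) - (p.2 : 'rV[R]_n).

Lemma measurable_subRn : measurable_fun setT subRn.
Proof. exact: measurable_borelRnB. Qed.

HB.instance Definition _ :=
  isMeasurableFun.Build _ _ _ _ subRn measurable_subRn.

Definition autocorr : set (borelRn R n) -> \bar R :=
  pushforward (mprod mu mu) subRn.

Let autocorr0 : autocorr set0 = 0%E.
Proof. by rewrite /autocorr /pushforward preimage_set0 measure0. Qed.

Let autocorr_ge0 A : (0 <= autocorr A)%E.
Proof. exact: measure_ge0. Qed.

Let autocorr_sigma_additive : semi_sigma_additive autocorr.
Proof. exact: measure_semi_sigma_additive. Qed.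

HB.instance Definition _ := isMeasure.Build _ _ _ autocorr
  autocorr0 autocorr_ge0 autocorr_sigma_additive.

Let autocorr_fin : fin_num_fun autocorr.
Proof.
move=> A mA; rewrite /autocorr /pushforward fin_num_measure//.
by rewrite -[X in measurable X]setTI; exact: measurable_subRn.
Qed.

HB.instance Definition _ := Measure_isFinite.Build _ _ _ autocorr autocorr_fin.

(** The squares of the cosine and sine integrals are double integrals over [mu] x [mu], and [cos a *
    cos b + sin a * sin b = cos (a - b)] merges them into one function of [x - y]. *)
Lemma normc_fourier (z : 'rV[R]_n) :
  ComplexField.Normc.normc (fourier mu z) ^+ 2 = cosft autocorr z.
Proof.
have mt : measurable_fun setT (fun x : borelRn R n => - (2 * pi * dotmul z x)).
  by apply: measurableT_comp => //; apply: measurable_funM => //; exact: measurable_dotmul.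
pose c (x : borelRn R n) := cos (- (2 * pi * dotmul z x)).
pose s (x : borelRn R n) := sin (- (2 * pi * dotmul z x)).
have mc : measurable_fun setT c by exact: measurable_cos.
have ms : measurable_fun setT s.
  apply: (measurableT_comp _ mt).
  by apply: continuous_measurable_fun; exact: continuous_sin.
have c1 x : `|c x| <= 1 by exact: cos_max.
have s1 x : `|s x| <= 1 by exact: sin_max.
rewrite /= sqr_sqrtr ?addr_ge0 ?sqr_ge0//.
apply: EFin_inj; rewrite EFinD !expr2.
rewrite (RintegralM mu mu mc c1 mc c1) (RintegralM mu mu ms s1 ms s1).
have mcs (f : borelRn R n -> R) : measurable_fun setT f -> (forall x, `|f x| <= 1) ->
    (mprod mu mu).-integrable setT (fun p => (f p.1 * f p.2)%:E).
  move=> mf f1.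
  apply: (@integrable_le1 _ _ _ (mprod mu mu) (fun p => f p.1 * f p.2)).
    by apply: measurable_funM; [apply: (measurableT_comp mf)|apply: (measurableT_comp mf)].
  by move=> p; rewrite normrM mulr_ile1.
rewrite -integralD//; [|exact: mcs..].
have mcz : measurable_fun setT (fun w : borelRn R n => cos (2 * pi * dotmul z w)).
  by apply: measurable_cos; apply: measurable_funM => //; exact: measurable_dotmul.
rewrite /cosft EFin_Rintegral//; last by move=> x; exact: cos_max.
transitivity (\int[pushforward (mprod mu mu) subRn]_w (cos (2 * pi * dotmul z w))%:E)%E => //.
rewrite (integral_pushforward measurable_subRn)//; last 2 first.
- exact/measurable_EFinP.
- rewrite preimage_setT; apply: (@integrable_le1 _ _ _ (mprod mu mu)
    (fun p => cos (2 * pi * dotmul z (subRn p)))).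
    exact: (measurableT_comp mcz measurable_subRn).
  by move=> p; exact: cos_max.
rewrite preimage_setT; apply: eq_integral => p _.
rewrite -EFinD /c /s /= !cosN !sinN mulrNN.
by rewrite dotmulBr mulrBr cosB.
Qed.

(** [S] x [S] lies in the preimage of [A] under subtraction, so a set of positive [mu] mass forces
    positive autocorrelation mass on its differences. *)
Lemma autocorr_setX (S A : set (borelRn R n)) : measurable S -> measurable A ->
  (forall x y, S x -> S y -> A (x - y)) -> (mu S * mu S <= autocorr A)%E.
Proof.
move=> mS mA SA; rewrite -product_measure1E//.
apply: le_measure; rewrite ?inE//.
- exact: measurableX.
- by rewrite -[X in measurable X]setTI; exact: measurable_subRn.
by move=> p [Sx Sy]; exact: SA.
Qed.

End autocorrelation.

Section support.
Context {R : realType} {n : nat}.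
Variable mu : {measure set (borelRn R n) -> \bar R}.

Lemma closed_msupport : closed (msupport mu).
Proof. by apply: closed_bigI => F []. Qed.

(** The complement is a possibly uncountable union of null open sets. By the Lindelof argument each
    of its points lies in a null rational ball, and there are countably many of these. *)
Lemma msupport_conull : mu (~` msupport mu) = 0%E.
Proof.
pose G (p : 'rV[rat]_n * nat) : set (borelRn R n) :=
  if pselect (mu (@rat_ball R n p) = 0%E) is left _ then @rat_ball R n p else set0.
have mG p : measurable (G p).
  rewrite /G; case: pselect => // _.
  by apply: open_measurable_borelRn; exact: ball_open.
have G0 p : mu (G p) = 0%E by rewrite /G; case: pselect.
pose H k := if unpickle k is Some p then G p else set0.
have Hneg k : mu.-negligible (H k).
  rewrite /H; case: unpickle => [p|]; last exact: negligible_set0.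
  by apply/negligibleP => //; exact: G0.
have mC : measurable (~` msupport mu : set (borelRn R n)).
  by apply: measurableC; apply: closed_measurable_borelRn; exact: closed_msupport.
apply/negligibleP => //; apply: negligibleS (negligible_bigcup Hneg).
rewrite /msupport setC_bigcap => x [F [cF F0] Fx].
have := Fx; rewrite {1}(open_bigcup_rat_ball (closed_openC cF)) => -[p /= pF px].
exists (pickle p) => //; rewrite /H pickleK /G; case: pselect => // -[].
apply/eqP; rewrite eq_le measure_ge0 andbT -F0; apply: le_measure => //; rewrite inE.
  by apply: open_measurable_borelRn; exact: ball_open.
by apply: open_measurable_borelRn; exact: closed_openC.
Qed.

End support.

(** The support is the countable union of its bounded closed pieces [S k]; were they all null, the
    whole space would be null too. *)
Lemma exists_compact_positive (R : realType) (n : nat)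
    (mu : {measure set (borelRn R n) -> \bar R}) :
  mu [set: borelRn R n] != 0%E ->
  exists S : set 'rV[R]_n, [/\ compact S, S `<=` msupport mu & mu S != 0%E].
Proof.
move=> muT; pose S k := msupport mu `&` [set x : 'rV[R]_n | `|x| <= k%:R].
have cS k : closed (S k).
  apply: closedI; first exact: closed_msupport.
  by apply: (closed_comp _ (@closed_le R k%:R)) => x _; exact: norm_continuous.
have mS k : measurable (S k : set (borelRn R n)) by exact: closed_measurable_borelRn.
have [[k Sk]|/forallNP S0] := pselect (exists k, mu (S k) != 0%E).
  exists (S k); split=> //; last by move=> x [].
  apply: bounded_closed_compact => //.
  by exists k%:R; split=> [|r kr x [_ /= xk]]; rewrite ?num_real// (le_trans xk)// ltW.
exfalso; move/eqP: muT; apply.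
apply/negligibleP => //.
have : mu.-negligible (~` msupport mu `|` \bigcup_k S k).
  apply: negligibleU.
    apply/negligibleP; last exact: msupport_conull.
    by apply: measurableC; apply: closed_measurable_borelRn; exact: closed_msupport.
  apply: negligible_bigcup => k; apply/negligibleP => //.
  by apply/eqP/negPn/negP; exact: S0.
apply: negligibleS => x _.
have [sx|sx] := pselect (msupport mu x); [right|by left].
exists (Num.truncn `|x|).+1 => //; split=> //=.
exact: ltW (truncnS_gt _).
Qed.

(** * Contradiction from a null distance set *)

Local Open Scope ereal_scope.

Theorem corollary7p4 (R : realType) (d : nat)
    (mu : {finite_measure set (borelRn R d) -> \bar R}) :
  (0 < d)%N ->
  mu [set: borelRn R d] != 0 ->
  \int[lebesgue_Rn R d]_z ((ComplexField.Normc.normc (fourier mu z)) ^+ 4)%:E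
    < +oo ->
  0 < lebesgue_measure (distance_set (msupport mu)).
Proof.
case: d mu => [//|d] mu _ muT fourier4.
have [S [cS Ssupp muS]] := exists_compact_positive muT.
(* The fourth power of the transform of [mu] is the square of that of its autocorrelation, so the
   hypothesis is exactly finite energy. *)
have cosft2 : \int[lebesgue_Rn R d.+1]_z (cosft (autocorr mu) z ^+ 2)%:E < +oo.
  apply: le_lt_trans fourier4; rewrite le_eqVlt; apply/orP; left; apply/eqP.
  by apply: eq_integral => z _; rewrite -normc_fourier -exprM.
have [C nuC] := near_diagonal_le cosft2.
rewrite lt0e outer_measure_ge0 andbT; apply/negP => /eqP D0.
(* Working with the compact [S] makes the difference set and its set of norms compact, hence
   measurable; the distance set itself is only compared through outer measure. *)
pose A := [set (p.1 - p.2)%R | p in S `*` S].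
have cA : compact A.
  apply: continuous_compact; last exact: compact_setX.
  by apply: continuous_subspaceT; exact: sub_continuous.
have clA : closed A by apply: compact_closed => //; exact: norm_hausdorff.
pose E := @enorm R d.+1 @` A.
have cE : compact E.
  apply: continuous_compact => //.
  by apply: continuous_subspaceT; exact: continuous_enorm.
have mE : measurable E by exact: compact_measurable.
have E0 : lebesgue_measure E = 0.
  apply/eqP; rewrite eq_le measure_ge0 andbT -D0; apply: le_outer_measure.
  move=> _ [_ [p [/Ssupp p1 /Ssupp p2] <-] <-].
  by exists p.1 => //; exists p.2.
have mA : measurable (A : set (borelRn R d.+1)) by exact: closed_measurable_borelRn.
have LA : lebesgue_Rn R d.+1 A = 0.
  apply/eqP; rewrite eq_le measure_ge0 andbT -(enorm_preimage_null d mE E0).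
  apply: le_measure; rewrite ?inE//; last by move=> x Ax; exists x.
  have me := continuous_measurable_borelRn (@continuous_enorm R d.+1).
  by have := me measurableT E mE; rewrite setTI.
have nuA := null_compact nuC clA (compact_bounded cA) LA.
have clS : closed S by apply: compact_closed => //; exact: norm_hausdorff.
have mS : measurable (S : set (borelRn R d.+1)) by exact: closed_measurable_borelRn.
(* The autocorrelation vanishes on the null compact set [A], yet all differences of points of [S]
   lie in it. *)
have : mu S * mu S <= 0.
  rewrite -nuA; apply: autocorr_setX => // x y Sx Sy.
  by exists (x, y).
by apply/negP; rewrite -ltNge; apply: mule_gt0; rewrite lt0e muS measure_ge0.
Qed.
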